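(* Let $r\le e\le q$ be positive integers with $r+e+q=n$, let $P_1=(x_1,\dots,x_r)$, $P_2=(x_{r+1},\dots,x_{r+e})$, $P_3=(x_{r+e+1},\dots,x_{r+e+q})$ be prime ideals of $S=K[x_1,\dots,x_n]$, and let $I=P_1\cap P_2\cap P_3$. Then $$\operatorname{sdepth}(S/I)\le e+\left\lceil\frac{q}{2}\right\rceil.$$
   Context: $K$ is a field and $S=K[x_1,\dots,x_n]$ is the polynomial ring, with its standard $\mathbb{Z}^n$-grading. Let $M$ be a finitely generated $\mathbb{Z}^n$-graded $S$-module. For a homogeneous $u\in M$ and a subset $Z\subset\{x_1,\dots,x_n\}$, $uK[Z]$ denotes the $K$-subspace of $M$ generated by all $uv$, $v$ a monomial in $K[Z]$; if $uK[Z]$ is a free $K[Z]$-module it is called a Stanley space of dimension $|Z|$. A Stanley decomposition of $M$ is a presentation of $M$ as a finite direct sum of $\mathbb{Z}^n$-graded $K$-vector spaces $\mathcal{D}: M=\bigoplus_{i=1}^{s}u_iK[Z_i]$ with each $u_iK[Z_i]$ a Stanley space; $\operatorname{sdepth}\mathcal{D}=\min_i|Z_i|$, and $\operatorname{sdepth} M$ is the maximum of $\operatorname{sdepth}\mathcal{D}$ over all Stanley decompositions $\mathcal{D}$ of $M$. *)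

(* Defs.v *)
From HB Require Import structures.
From mathcomp Require Import all_boot all_order all_algebra.
From mathcomp Require Import boolp.
From mathcomp.multinomials Require Import mpoly.

Set Implicit Arguments.
Unset Strict Implicit.
Unset Printing Implicit Defensive.

Import GRing.Theory.
Local Open Scope ring_scope.
Local Open Scope quotient_scope.

Notation multideg n := {ffun 'I_n -> int}.

Definition multideg_of n (m : 'X_{1..n}) : multideg n := [ffun i => (m i)%:Z].

Section GradedModules.
Variables (K : fieldType) (n : nat).
Local Notation S := {mpoly K[n]}.

(* An S-module is a K-vector space through the constants c%:MP. *)

Definition is_Ksubspace (M : lmodType S) (V : M -> Prop) : Prop :=
  V 0 /\ forall (c : K) (u v : M), V u -> V v -> V (c%:MP *: u + v).

Definition finitely_generated (M : lmodType S) : Prop :=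
  exists (k : nat) (g : 'I_k -> M),
    forall w : M, exists c : 'I_k -> S, w = \sum_(j < k) c j *: g j.

(* [piece a] is the component M_a; the last two conditions say that M is the
   direct sum of its components. *)
Definition is_grading (M : lmodType S) (piece : multideg n -> M -> Prop) : Prop :=
  [/\ forall a, is_Ksubspace (piece a),
      forall (m : 'X_{1..n}) a w,
        piece a w -> piece (multideg_of m + a) ('X_[m] *: w),
      forall w : M, exists (s : seq (multideg n)) (f : multideg n -> M),
        (forall a, piece a (f a)) /\ w = \sum_(a <- s) f a
    & forall (s : seq (multideg n)) (f : multideg n -> M),
        uniq s -> (forall a, piece a (f a)) -> \sum_(a <- s) f a = 0 ->
        forall a, a \in s -> f a = 0].

Record fgGradedModule := FgGradedModule {
  gm_sort :> lmodType S;
  gm_piece : multideg n -> gm_sort -> Prop;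
  gm_graded : is_grading gm_piece;
  gm_fg : finitely_generated gm_sort }.

Definition homogeneous (M : fgGradedModule) (u : M) : Prop :=
  exists a, gm_piece a u.

End GradedModules.

Section StanleyDepth.
Variables (K : fieldType) (n : nat).
Local Notation S := {mpoly K[n]}.

Definition monomial_in (Z : {set 'I_n}) (m : 'X_{1..n}) : bool :=
  [forall i, (0 < m i)%N ==> (i \in Z)].

(* the subring K[Z] of S *)
Definition subring_in (Z : {set 'I_n}) (p : S) : bool :=
  all (monomial_in Z) (msupp p).

Definition Kspan (M : lmodType S) (A : M -> Prop) (w : M) : Prop :=
  exists (k : nat) (c : 'I_k -> K) (v : 'I_k -> M),
    (forall j, A (v j)) /\ w = \sum_(j < k) (c j)%:MP *: v j.

(* the K-subspace u K[Z] of M *)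
Definition uKZ (M : lmodType S) (u : M) (Z : {set 'I_n}) : M -> Prop :=
  Kspan (fun w => exists2 m, monomial_in Z m & w = 'X_[m] *: u).

(* Freeness means free with basis u, so that u K[Z] is isomorphic to K[Z] and
   has dimension |Z|; in particular u <> 0. *)
Definition is_Stanley_space (M : lmodType S) (u : M) (Z : {set 'I_n}) : Prop :=
  forall w, uKZ u Z w -> exists! p : S, subring_in Z p /\ w = p *: u.

(* The summands are graded subspaces because their generators are
   homogeneous. *)
Record Stanley_decomposition (M : fgGradedModule K n) := StanleyDecomposition {
  sd_len : nat;
  sd_gen : 'I_sd_len -> M;
  sd_vars : 'I_sd_len -> {set 'I_n};
  sd_homogeneous : forall i, homogeneous (sd_gen i);
  sd_Stanley : forall i, is_Stanley_space (sd_gen i) (sd_vars i);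
  sd_direct_sum : forall w : M, exists! f : {ffun 'I_sd_len -> M},
    (forall i, uKZ (sd_gen i) (sd_vars i) (f i)) /\ w = \sum_i f i }.

(* The default value n of the minimum only matters for the empty decomposition,
   that is, for M = 0. *)
Definition sdepth_decomposition (M : fgGradedModule K n)
    (D : Stanley_decomposition M) : nat :=
  \big[minn/n]_(i < sd_len D) #|sd_vars i|.

(* The Stanley depth of a decomposition is at most n, so d ranges over all
   possible values. *)
Definition sdepth (M : fgGradedModule K n) : nat :=
  \max_(d < n.+1 |
    `[< exists D : Stanley_decomposition M, sdepth_decomposition D = d >]) d.

End StanleyDepth.

Section QuotientModule.
Variables (R : comNzRingType) (I : idealr R).

Definition quot_scale (a : R) (w : {ideal_quot I}) : {ideal_quot I} :=
  \pi_({ideal_quot I}) a * w.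

Fact quot_scaleA a b w : quot_scale a (quot_scale b w) = quot_scale (a * b) w.
Proof. by rewrite /quot_scale mulrA rmorphM. Qed.

Fact quot_scale1 : left_id 1 quot_scale.
Proof. by move=> w; rewrite /quot_scale rmorph1 mul1r. Qed.

Fact quot_scaleDr : right_distributive quot_scale +%R.
Proof. by move=> a v w; rewrite /quot_scale mulrDr. Qed.

Fact quot_scaleDl w : {morph quot_scale^~ w : a b / a + b}.
Proof. by move=> a b; rewrite /quot_scale rmorphD mulrDl. Qed.

HB.instance Definition _ := GRing.Zmodule_isLmodule.Build R {ideal_quot I}
  quot_scaleA quot_scale1 quot_scaleDr quot_scaleDl.

Lemma quot_scaleE a b :
  a *: (\pi_({ideal_quot I}) b) = \pi_({ideal_quot I}) (a * b).
Proof. by rewrite rmorphM. Qed.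

Lemma quot_eq0 a : (\pi_({ideal_quot I}) a == 0) = (a \in I).
Proof. by rewrite -(rmorph0 \pi_({ideal_quot I})) -Quotient.idealrBE subr0. Qed.

End QuotientModule.

HB.mixin Record isMonomialIdeal (K : fieldType) (n : nat)
    (I : {mpoly K[n]} -> bool) := {
  monomial_ideal_subproof :
    forall p m, I p -> m \in msupp p -> I 'X_[m] }.

#[short(type="monomialIdeal")]
HB.structure Definition MonomialIdeal (K : fieldType) (n : nat) :=
  {I of Idealr {mpoly K[n]} I & isMonomialIdeal K n I}.

Section GradedQuotient.
Variables (K : fieldType) (n : nat) (I : monomialIdeal K n).
Local Notation S := {mpoly K[n]}.

Definition mpoly_piece (a : multideg n) (p : S) : Prop :=
  forall m, m \in msupp p -> multideg_of m = a.

Definition quot_piece (a : multideg n) (w : {ideal_quot I}) : Prop :=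
  exists2 p : S, mpoly_piece a p & w = \pi_({ideal_quot I}) p.

Lemma multideg_of_inj : injective (@multideg_of n).
Proof.
move=> m1 m2 /ffunP e; apply/mnmP => i.
by have := e i; rewrite !ffunE => -[].
Qed.

Lemma quot_graded : is_grading quot_piece.
Proof.
split.
- move=> a; split; first by exists 0; rewrite ?rmorph0 // => m; rewrite msupp0.
  move=> c _ _ [p hp ->] [q hq ->]; exists (c%:MP * p + q).
    move=> m /msuppD_le; rewrite mem_cat => /orP[|/hq //].
    by rewrite mul_mpolyC => /msuppZ_le /hp.
  by rewrite quot_scaleE rmorphD.
- move=> m a _ [p hp ->]; exists ('X_[m] * p); last by rewrite quot_scaleE.
  move=> m'; rewrite mcoeff_msupp mulrC => h.
  have {h} : m' \in [seq (m + m1)%MM | m1 <- msupp p].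
    by rewrite -(perm_mem (msuppMX p m)) mcoeff_msupp.
  case/mapP => m1 /hp <- ->; apply/ffunP => i.
  by rewrite !ffunE mnmDE PoszD.
- move=> w; rewrite -[w]reprK; move: (repr w) => p.
  exists [seq multideg_of m | m <- msupp p].
  exists (fun a => \pi_({ideal_quot I})
            (\sum_(m <- msupp p | multideg_of m == a) p@_m *: 'X_[m])).
  split=> [a|].
    eexists; last by [].
    move=> m; apply: contraTeq => nm; rewrite mcoeff_msupp negbK raddf_sum /=.
    rewrite big1 // => m1 /eqP e; rewrite mcoeffZ mcoeffX.
    case: eqP => [e1|_]; last by rewrite mulr0.
    by rewrite -e e1 eqxx in nm.
  rewrite big_map -raddf_sum; congr (\pi_({ideal_quot I}) _).
  rewrite {1}[p]mpolyE; apply: eq_big_seq => m hm.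
  under eq_bigl => m1 do rewrite (inj_eq multideg_of_inj).
  by rewrite -big_filter filter_pred1_uniq ?msupp_uniq // big_seq1.
- move=> s f us hf s0 a as_.
  have /choice [g hg] : forall b, exists p : S,
      mpoly_piece b p /\ f b = \pi_({ideal_quot I}) p.
    by move=> b; case: (hf b) => p; exists p.
  have sI : \sum_(b <- s) g b \in I.
    rewrite -quot_eq0 raddf_sum; apply/eqP; rewrite -[RHS]s0.
    by apply: eq_bigr => b _; rewrite (hg b).2.
  rewrite (hg a).2; apply/eqP; rewrite quot_eq0 [g a]mpolyE big_seq.
  apply: rpred_sum => m hm; rewrite -mul_mpolyC idealMr //.
  apply: (monomial_ideal_subproof _ _ sI).
  rewrite mcoeff_msupp raddf_sum (bigD1_seq a) //= big1 ?addr0 -?mcoeff_msupp //.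
  move=> b nba; apply/eqP; rewrite mcoeff_eq0; apply/negP => /(hg b).1 e.
  by move: nba; rewrite -e (hg a).1 ?eqxx.
Qed.

Lemma quot_fg : finitely_generated {ideal_quot I}.
Proof.
exists 1%N, (fun=> 1) => w; exists (fun=> repr w).
by rewrite big_ord1 -[1](rmorph1 \pi_({ideal_quot I})) quot_scaleE mulr1 reprK.
Qed.

(* S/I, graded by the images of the components of S *)
Definition graded_quot : fgGradedModule K n :=
  FgGradedModule quot_graded quot_fg.

End GradedQuotient.

Section VariableIdeals.
Variables (K : fieldType) (n : nat).
Local Notation S := {mpoly K[n]}.

(* the ideal generated by the variables x_i with i in A *)
Definition var_ideal (A : {set 'I_n}) (p : S) : bool :=
  `[< exists c : 'I_n -> S, p = \sum_(i in A) c i * 'X_i >].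

Lemma var_ideal_closed A : idealr_closed (var_ideal A : {pred S}).
Proof.
split.
- by apply/asboolP; exists (fun=> 0); rewrite big1 // => i _; rewrite mul0r.
- apply/negP => /asboolP [c /(congr1 (mcoeff 0))].
  rewrite mcoeff1 eqxx raddf_sum big1 /= => [/eqP|i _]; first by rewrite oner_eq0.
  apply/eqP; rewrite mcoeff_eq0 (perm_mem (msuppMX _ _)).
  apply/mapP => -[m _ /mnmP /(_ i)].
  by rewrite mnm0E mnmDE mnm1E eqxx.
- move=> a p q /asboolP [c ->] /asboolP [d ->]; apply/asboolP.
  exists (fun i => a * c i + d i); rewrite mulr_sumr -big_split /=.
  by apply: eq_bigr => i _; rewrite mulrDl mulrA.
Qed.

HB.instance Definition _ A :=
  isIdealr.Build S (var_ideal A) (var_ideal_closed A).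

Lemma var_ideal_monomial A p m :
  var_ideal A p -> m \in msupp p -> var_ideal A 'X_[m].
Proof.
move=> /asboolP [c ->] hm.
have [i iA mi] : exists2 i, i \in A & (0 < m i)%N.
  apply/exists_inP; apply: contraTT hm; rewrite negb_exists_in => /forall_inP h.
  rewrite mcoeff_msupp negbK raddf_sum big1 //= => i /h.
  rewrite -eqn0Ngt => /eqP mi; apply/eqP.
  rewrite mcoeff_eq0 (perm_mem (msuppMX _ _)).
  by apply/mapP => -[m1 _ e]; move: mi; rewrite e mnmDE mnm1E eqxx.
apply/asboolP; exists (fun j => if j == i then 'X_[m - U_(i)] else 0).
rewrite (bigD1 i) //= eqxx big1 ?addr0.
  by rewrite -mpolyXD submK // lep1mP -lt0n.
by move=> j /andP[_ /negPf ->]; rewrite mul0r.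
Qed.

HB.instance Definition _ A :=
  isMonomialIdeal.Build K n (var_ideal A) (@var_ideal_monomial A).

Definition ideal_cap (I J : monomialIdeal K n) (p : S) : bool :=
  (p \in I) && (p \in J).

Lemma ideal_cap_closed I J : idealr_closed (ideal_cap I J : {pred S}).
Proof.
split; first by apply/andP; rewrite !rpred0.
- by apply/negP => /andP[]; rewrite idealr1.
- move=> a p q /andP[pI pJ] /andP[qI qJ]; apply/andP.
  by rewrite !rpredD ?idealMr.
Qed.

HB.instance Definition _ I J :=
  isIdealr.Build S (ideal_cap I J) (ideal_cap_closed I J).

Lemma ideal_cap_monomial I J p m :
  ideal_cap I J p -> m \in msupp p -> ideal_cap I J 'X_[m].
Proof.
by move=> /andP[pI pJ] hm; apply/andP; split; apply: monomial_ideal_subproof hm.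
Qed.

HB.instance Definition _ I J :=
  isMonomialIdeal.Build K n (ideal_cap I J) (@ideal_cap_monomial I J).

End VariableIdeals.

Arguments var_ideal K {n} A p.

(* Main.v *)
Require Import Defs.
From mathcomp Require Import all_boot all_order all_algebra.
From mathcomp Require Import boolp.
From mathcomp.multinomials Require Import mpoly.
From mathcomp Require Import zify.

(** Write A, B, C for the sets of variables generating P1, P2, P3. A monomial
    lies in I exactly when it involves a variable of each of A, B and C.

    Let Mon(Z) be the monoid of monomials in the variables of Z. Since the
    components of S/I have dimension at most one, a homogeneous generator is a
    multiple of the class of a monomial, and a Stanley decomposition of S/I
    yields a partition of the monomials outside I into sets g_i * Mon(Z_i), one
    for each Stanley space ([Stanley_decomposition_partition]). It remains to
    bound the smallest |Z_i| combinatorially.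

    Fix one variable x_a of A and let g_0 * Mon(Z_0) be the set containing x_a.
    As x_a * Mon(Z_0) avoids I, Z_0 cannot meet both B and C; let G be one of
    B, C that it misses. For j in G the monomial x_a x_j lies in some other set
    g_f(j) * Mon(Z_f(j)). If x_j did not divide g_f(j), dividing by x_j would
    put x_a in the same set, forcing j into Z_0; so x_j divides g_f(j), and f is
    injective. Now
    - Z_f(j) is contained in A together with G, because a variable of the
      remaining block would lead from x_a x_j into I;
    - for distinct j, k in G we cannot have both k in Z_f(j) and j in Z_f(k),
      since x_a x_j x_k lies in only one set.
    So the arcs j -> k, for distinct j, k in G with k in Z_f(j), define an oriented graph on G in which every
    vertex has out-degree at least d - |A| - 1, where d is the smallest |Z_i|.
    Some vertex has out-degree at most (|G| - 1) / 2
    ([out_degree_asymmetric]), and therefore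
    d <= |A| + ceil(|G| / 2) ([partition_sdepth_le]). This gives
    sdepth S/I <= |A| + max(ceil(|B| / 2), ceil(|C| / 2))
    ([sdepth_quot_transversal_le]), and with |A| = r <= e = |B| <= q = |C| the
    right-hand side is r + ceil(q / 2) <= e + ceil(q / 2). *)

Set Implicit Arguments.
Unset Strict Implicit.
Unset Printing Implicit Defensive.

Import GRing.Theory.
Local Open Scope ring_scope.
Local Open Scope quotient_scope.

(** * Oriented graphs *)

(** Double counting: an oriented graph has at most |G| (|G| - 1) / 2 arcs, so
    its out-degrees cannot all exceed (|G| - 1) / 2. *)
Lemma out_degree_asymmetric (T : finType) (G : {set T}) (N : T -> {set T}) t :
    (0 < #|G|)%N ->
    (forall j, j \in G -> N j \subset G :\ j) ->
    (forall j k, j \in G -> k \in G -> k \in N j -> j \notin N k) ->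
    (forall j, j \in G -> t <= #|N j|)%N ->
  (t.*2 < #|G|)%N.
Proof.
move=> G0 sub asym deg.
have degE j : j \in G -> #|N j| = (\sum_(k in G) (k \in N j))%N.
  move=> jG; rewrite -big_mkcondr /= sum1dep_card; apply: eq_card => k.
  rewrite !inE; case kN: (k \in N j); rewrite ?andbF // andbT.
  by have := subsetP (sub j jG) k kN; rewrite !inE => /andP[].
have lower : (#|G| * t <= \sum_(j in G) \sum_(k in G) (k \in N j))%N.
  rewrite -sum_nat_const; apply: leq_sum => j jG.
  by rewrite -degE ?deg.
have upper : ((\sum_(j in G) \sum_(k in G) (k \in N j)).*2
    <= #|G| * #|G|.-1)%N.
  rewrite -addnn {2}exchange_big /= -big_split /= -sum_nat_const.
  apply: leq_sum => j jG; rewrite -big_split /=.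
  rewrite (cardsD1 j G) jG add1n /= -sum1_card.
  rewrite [leqRHS](eq_bigl (fun k => (k \in G) && (k != j))); last first.
    by move=> k; rewrite !inE andbC.
  rewrite big_mkcondr /=; apply: leq_sum => k kG.
  have [->|_] := eqVneq k j.
    by case jN: (j \in N j) => //; have := subsetP (sub j jG) j jN; rewrite !inE eqxx.
  case kN: (k \in N j); last by case: (j \in N k).
  by rewrite (negPf (asym j k jG kG kN)).
have : (#|G| * t.*2 <= #|G| * #|G|.-1)%N.
  by rewrite -doubleMr; apply: leq_trans upper; rewrite leq_double.
by rewrite leq_pmul2l // -{2}(prednK G0) ltnS.
Qed.

(** * Partitions of a set of monomials into translated monoids *)

Section MonomialSpaces.
Variable n : nat.
Implicit Types (g m v : 'X_{1..n}) (Z G Y : {set 'I_n}).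

(** The monomials of the Stanley space u K[Z], for u a multiple of the class
    of 'X_[g]. *)
Definition in_space g Z m : bool := (g <= m)%MM && monomial_in Z (m - g)%MM.

Lemma in_spaceP g Z m :
  reflect (exists2 z, monomial_in Z z & m = (g + z)%MM) (in_space g Z m).
Proof.
apply: (iffP andP) => [[le_gm Zm]|[z Zz ->]].
  by exists (m - g)%MM; rewrite // addmC submK.
by rewrite lem_addr // addmC addmK.
Qed.

Lemma in_space_mulX g Z m k :
  in_space g Z m -> k \in Z -> in_space g Z (m + U_(k))%MM.
Proof.
move=> /in_spaceP[z /forallP Zz ->] kZ; apply/in_spaceP.
exists (z + U_(k))%MM; last by rewrite addmA.
apply/forallP => i; apply/implyP; rewrite mnmDE mnm1E.
have [<- //|_] := eqVneq k i; rewrite addn0; exact/implyP.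
Qed.

(** When x_j does not divide the generator, it can only come from K[Z]; so j is
    in Z and x_j can be divided out without leaving the space. *)
Lemma in_space_divX g Z m j :
    in_space g Z (m + U_(j))%MM -> g j = 0%N ->
  j \in Z /\ in_space g Z m.
Proof.
move=> /in_spaceP[z /forallP Zz e] gj0.
have ej i : (m i + (j == i) = g i + z i)%N.
  by move/mnmP: e => /(_ i); rewrite !mnmDE mnm1E.
have zj : (0 < z j)%N by have := ej j; rewrite eqxx gj0; lia.
split; first exact: implyP (Zz j) zj.
apply/in_spaceP; exists (z - U_(j))%MM; last first.
  apply/mnmP => i; rewrite mnmDE mnmBE mnm1E; have := ej i.
  by case: eqVneq => [<-|_] /=; lia.
apply/forallP => i; apply/implyP; rewrite mnmBE => zi.
by apply: (implyP (Zz i)); lia.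
Qed.

Definition space_partition (I : finType) (g : I -> 'X_{1..n})
    (Z : I -> {set 'I_n}) (P : 'X_{1..n} -> Prop) : Prop :=
  [/\ forall i m, in_space (g i) (Z i) m -> P m,
      forall m, P m -> exists i, in_space (g i) (Z i) m
    & forall i k m, in_space (g i) (Z i) m -> in_space (g k) (Z k) m -> i = k].

(** The counting bound for the spaces through the monomials v x_j, j in G. It
    applies to a set P of monomials in which only variables of Y and G extend
    such a monomial, and to a v whose own space does not involve G. *)
Lemma partition_sdepth_le (I : finType) (g : I -> 'X_{1..n})
    (Z : I -> {set 'I_n}) (P : 'X_{1..n} -> Prop) (d : nat)
    (v : 'X_{1..n}) (i0 : I) (Y G : {set 'I_n}) :
    space_partition g Z P -> (forall i, d <= #|Z i|)%N ->
    in_space (g i0) (Z i0) v -> [disjoint Z i0 & G] ->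
    (0 < #|G|)%N ->
    (forall j, j \in G -> v j = 0%N) ->
    (forall j, j \in G -> P (v + U_(j))%MM) ->
    (forall j k, j \in G -> P (v + U_(j) + U_(k))%MM -> k \in Y :|: G) ->
  (d <= #|Y| + uphalf #|G|)%N.
Proof.
move=> [outP cover uniqP] leZ vi0 disj G0 vG PG PYG.
have /choice[f fP] : forall j, exists i,
    j \in G -> in_space (g i) (Z i) (v + U_(j))%MM.
  move=> j; case jG: (j \in G); last by exists i0.
  by case: (cover _ (PG j jG)) => i; exists i.
have gj j : j \in G -> (0 < g (f j) j)%N.
  move=> jG; rewrite lt0n; apply/eqP => gj0.
  have [jZ vf] := in_space_divX (fP j jG) gj0.
  have e := uniqP _ _ _ vf vi0.
  by move: jZ; rewrite e (disjointFl disj jG).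
have f_inj j k : j \in G -> k \in G -> f j = f k -> j = k.
  move=> jG kG fjk; apply/eqP; apply: contraT => njk.
  have /andP[/mnm_lepP /(_ j)] := fP k kG.
  rewrite -fjk mnmDE vG // mnm1E eq_sym (negPf njk) => le0.
  by have := gj j jG; lia.
have subYG j : j \in G -> Z (f j) \subset Y :|: G.
  move=> jG; apply/subsetP => k kZ.
  exact: PYG jG (outP _ _ (in_space_mulX (fP j jG) kZ)).
(* N j is the out-neighbourhood of j; removing Y and j from Z (f j) costs at
   most |Y| + 1 elements. *)
pose N j := (Z (f j) :\: Y) :\ j.
suff : ((d - #|Y|.+1).*2 < #|G|)%N by lia.
apply: (@out_degree_asymmetric _ G N) => // [j jG|j k jG kG|j jG].
- apply/subsetP => k; rewrite !inE => /and3P[-> kY kZ].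
  by have := subsetP (subYG j jG) k kZ; rewrite inE (negPf kY).
- rewrite !inE => /and3P[nkj _ kZ]; apply/negP => /and3P[_ _ jZ].
  have jk := in_space_mulX (fP j jG) kZ.
  have kj := in_space_mulX (fP k kG) jZ.
  have ejk : (v + U_(j) + U_(k) = v + U_(k) + U_(j))%MM.
    by rewrite -!addmA [(U_(j) + _)%MM]addmC.
  rewrite ejk in jk.
  by move: nkj; rewrite (f_inj j k jG kG (uniqP _ _ _ jk kj)) eqxx.
- have := leZ (f j); have := cardsID Y (Z (f j)).
  have := subset_leq_card (subsetIr (Z (f j)) Y).
  have := cardsD1 j (Z (f j) :\: Y); rewrite -/(N j).
  by case: (j \in _) => /=; lia.
Qed.

End MonomialSpaces.

(** * Stanley decompositions of the quotient by a monomial ideal *)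

Section FromDecomposition.
Variables (K : fieldType) (n : nat) (I : monomialIdeal K n).
Local Notation S := {mpoly K[n]}.

Lemma homogeneous_quotP (u : graded_quot I) :
    homogeneous u -> u <> 0 ->
  exists (c : K) (g : 'X_{1..n}),
    c != 0 /\ u = \pi_({ideal_quot I}) (c *: 'X_[g]).
Proof.
move=> [a [p hp ->]] p0.
have [g gp] : exists g, g \in msupp p.
  case e: (msupp p) => [|g s]; last by exists g; rewrite inE eqxx.
  by case: p0; move/eqP: e; rewrite msupp_eq0 => /eqP ->; rewrite rmorph0.
exists p@_g, g; split; first by rewrite -mcoeff_msupp.
congr (\pi_({ideal_quot I}) _); apply/mpolyP => m.
rewrite mcoeffZ mcoeffX; case: eqVneq => [<-|ngm]; first by rewrite mulr1.
rewrite mulr0; apply/eqP; rewrite mcoeff_eq0; apply: contra ngm => mp.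
by apply/eqP/(@multideg_of_inj n); rewrite (hp _ mp) (hp _ gp).
Qed.

(** Freeness keeps the spaces away from I, spanning makes them cover all
    monomials outside I, and directness of the sum makes them disjoint. *)
Lemma Stanley_decomposition_partition (D : Stanley_decomposition (graded_quot I)) :
  exists g : 'I_(sd_len D) -> 'X_{1..n},
    space_partition g (@sd_vars _ _ _ D) (fun m => 'X_[m] \notin I).
Proof.
pose u := @sd_gen _ _ _ D; pose Z := @sd_vars _ _ _ D.
have uKZ_X i z : monomial_in (Z i) z -> uKZ (u i) (Z i) ('X_[z] *: u i).
  move=> Zz; exists 1%N, (fun=> 1), (fun=> 'X_[z] *: u i).
  by split=> [_|]; [exists z | rewrite big_ord1 mpolyC1 scale1r].
have free i z : monomial_in (Z i) z -> 'X_[z] *: u i <> 0.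
  move=> Zz e0; have := sd_Stanley (uKZ_X i z Zz).
  move=> [p [_ pU]]; have e1 : p = 'X_[z].
    by apply: pU; split=> //; rewrite /subring_in msuppX /= Zz.
  have : p = 0 by apply: pU; rewrite /subring_in msupp0 e0 scale0r.
  by rewrite e1 => /eqP; rewrite -msupp_eq0 msuppX.
have mono0 A : monomial_in A (0%MM : 'X_{1..n}).
  by apply/forallP => j; rewrite mnm0E.
have /choice[cg cgP] : forall i, exists cg : K * 'X_{1..n},
    cg.1 != 0 /\ u i = \pi_({ideal_quot I}) (cg.1 *: 'X_[cg.2]).
  move=> i; have [|c [g cg]] := homogeneous_quotP (sd_homogeneous i).
    by have := free i 0%MM (mono0 _); rewrite mpolyX0 scale1r.
  by exists (c, g).
pose g i := (cg i).2; exists g.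
have Xu i z : 'X_[z] *: u i =
    \pi_({ideal_quot I}) ((cg i).1 *: 'X_[(g i + z)%MM]).
  by rewrite (cgP i).2 quot_scaleE -scalerAr -mpolyXD addmC.
have out i m : in_space (g i) (Z i) m -> 'X_[m] \notin I.
  move=> /in_spaceP[z Zz ->]; apply/negP => gI; apply: (free i z Zz).
  by apply/eqP; rewrite Xu quot_eq0 -mul_mpolyC idealMr.
split=> //.
- move=> m mI; apply: contrapT => none.
  have [f [[fP fE] _]] := sd_direct_sum D (\pi_({ideal_quot I}) 'X_[m]).
  (* Each component f i is a combination of classes of monomials in the i-th
     space, none of which is m; so it lifts to a polynomial without m in its
     support. Subtracting these lifts from 'X_[m] leaves an element of I with m
     in its support, and I is a monomial ideal. *)
  have /choice[p pP] : forall i, exists p : S,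
      p@_m = 0 /\ f i = \pi_({ideal_quot I}) p.
    move=> i; have [k [c [w [wP ->]]]] := fP i.
    have /choice[z zP] : forall j, exists z,
        monomial_in (Z i) z /\ w j = 'X_[z] *: u i.
      by move=> j; have [z] := wP j; exists z.
    exists (\sum_(j < k) (c j)%:MP * ((cg i).1 *: 'X_[(g i + z j)%MM])).
    split.
      rewrite raddf_sum big1 //= => j _.
      rewrite mcoeffCM mcoeffZ mcoeffX; case: eqP => [e|_]; last by rewrite !mulr0.
      by case: none; exists i; apply/in_spaceP; exists (z j); rewrite ?(zP j).1.
    rewrite raddf_sum; apply: eq_bigr => j _.
    by rewrite (zP j).2 Xu quot_scaleE.
  have : 'X_[m] - \sum_i p i \in I.
    rewrite -quot_eq0 raddfB /= raddf_sum fE subr_eq0; apply/eqP.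
    by apply: eq_bigr => i _; rewrite (pP i).2.
  move/(@monomial_ideal_subproof _ _ I _ m) => XI; move: mI; apply/negP/negPn.
  apply: XI; rewrite mcoeff_msupp mcoeffB mcoeffX eqxx raddf_sum big1 /=.
    by rewrite subr0 oner_eq0.
  by move=> i _; rewrite (pP i).1.
- move=> i k m mi mk; apply/eqP; apply: contraT => nik.
  pose x : graded_quot I := \pi_({ideal_quot I}) 'X_[m].
  have x0 : x <> 0 by move/eqP; rewrite quot_eq0; apply/negP/(out _ _ mi).
  have inK j : in_space (g j) (Z j) m -> uKZ (u j) (Z j) x.
    move=> /in_spaceP[z Zz e].
    exists 1%N, (fun=> (cg j).1^-1), (fun=> 'X_[z] *: u j); split.
      by move=> _; exists z.
    rewrite big_ord1 Xu quot_scaleE mul_mpolyC scalerA mulVf ?(cgP j).1 //.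
    by rewrite scale1r -e.
  have in0 j : uKZ (u j) (Z j) 0.
    exists 0%N, (fun=> 0), (fun=> 0); split; first by case.
    by rewrite big_ord0.
  have [f [_ fU]] := sd_direct_sum D x.
  (* The class of 'X_[m] would decompose both as itself in position i and as
     itself in position k. *)
  pose F j := [ffun l => if l == j then x else 0] : {ffun 'I_(sd_len D) -> graded_quot I}.
  have FP j : in_space (g j) (Z j) m -> f = F j.
    move=> mj; apply: fU; split=> [l|].
      by rewrite ffunE; case: eqP => [->|_]; [apply: inK | apply: in0].
    rewrite (bigD1 j) //= ffunE eqxx big1 ?addr0 // => l /negPf nlj.
    by rewrite ffunE nlj.
  have : F i = F k by rewrite -FP // -FP.
  by move/ffunP/(_ i); rewrite !ffunE eqxx (negPf nik).
Qed.

End FromDecomposition.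

Lemma sdepth_decomposition_le (K : fieldType) n (M : fgGradedModule K n)
    (D : Stanley_decomposition M) (i : 'I_(sd_len D)) :
  (sdepth_decomposition D <= #|sd_vars i|)%N.
Proof.
rewrite /sdepth_decomposition; move: (mem_index_enum i).
elim: (index_enum _) => [//|j s IH]; rewrite big_cons inE => /orP[/eqP <-|/IH].
  exact: geq_minl.
exact/leq_trans/geq_minr.
Qed.

(** * Ideals of monomials meeting each of three blocks of variables *)

Definition meets n (A : {set 'I_n}) (m : 'X_{1..n}) : bool :=
  [exists i in A, (0 < m i)%N].

Lemma var_ideal_mpolyX (K : fieldType) n (A : {set 'I_n}) m :
  ('X_[m] \in (var_ideal K A : monomialIdeal K n)) = meets A m.
Proof.
apply/idP/exists_inP => [/asboolP[c e]|[i iA mi]].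
  apply/exists_inP; apply: contraT; rewrite negb_exists_in => /forall_inP h.
  have /eqP := congr1 (mcoeff m) e.
  rewrite mcoeffX eqxx raddf_sum big1 ?oner_eq0 //= => i /h.
  rewrite -eqn0Ngt => /eqP mi; apply/eqP.
  rewrite mcoeff_eq0 (perm_mem (msuppMX _ _)).
  by apply/mapP => -[m1 _ em]; move: mi; rewrite em mnmDE mnm1E eqxx.
have -> : 'X_[m] = 'X_[m - U_(i)] * 'X_i :> {mpoly K[n]}.
  by rewrite -mpolyXD submK // lep1mP -lt0n.
apply: idealMr; apply/asboolP; exists (fun j => (j == i)%:R).
rewrite (bigD1 i) //= eqxx mul1r big1 ?addr0 // => j /andP[_ /negPf ->].
by rewrite mul0r.
Qed.

(** The bound for the intersection of three monomial primes whose sets of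
    variables A, B, C partition all variables. Multiplying by one variable of A
    reduces to monomials that miss B or miss C. *)
Lemma sdepth_quot_transversal_le (K : fieldType) n (I : monomialIdeal K n)
    (A B C : {set 'I_n}) :
    (0 < #|A|)%N -> (0 < #|B|)%N -> (0 < #|C|)%N ->
    [disjoint A & B] -> [disjoint A & C] -> [disjoint B & C] ->
    (forall i, [|| i \in A, i \in B | i \in C]) ->
    (forall m, ('X_[m] \in I) = [&& meets A m, meets B m & meets C m]) ->
  (sdepth (graded_quot I) <= #|A| + maxn (uphalf #|B|) (uphalf #|C|))%N.
Proof.
move=> /card_gt0P[a aA] B0 C0 AB AC BC cov memI.
apply/bigmax_leqP => d /asboolP[D Dd].
have leZ i : (d <= #|sd_vars (s:=D) i|)%N.
  by rewrite -Dd sdepth_decomposition_le.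
have [g part] := Stanley_decomposition_partition D.
have [inner cover _] := part.
pose v : 'X_{1..n} := U_(a)%MM.
have v1 : v a = 1%N by rewrite mnm1E eqxx.
have v0 j : j \notin A -> v j = 0%N.
  by rewrite mnm1E; case: eqVneq => // <-; rewrite aA.
have vI : 'X_[v] \notin I.
  rewrite memI; apply/negP => /and3P[_ /exists_inP[i iB]].
  by rewrite v0 // (disjointFl AB iB).
have [i0 vi0] := cover _ vI.
(* B and C play symmetric roles; G is the one missed by the space of x_a. *)
have bound (G H : {set 'I_n}) : (0 < #|G|)%N ->
    [disjoint A & G] -> [disjoint A & H] -> [disjoint G & H] ->
    (forall i, [|| i \in A, i \in G | i \in H]) ->
    (forall m, ('X_[m] \in I) = [&& meets A m, meets G m & meets H m]) ->
    [disjoint sd_vars (s:=D) i0 & G] -> (d <= #|A| + uphalf #|G|)%N.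
  move=> G0 AG AH GH covGH memGH disj.
  apply: (partition_sdepth_le part leZ vi0 disj G0) => [j jG|j jG|j k jG].
  - by rewrite v0 // (disjointFl AG jG).
  - rewrite memGH; apply/negP => /and3P[_ _ /exists_inP[i iH]].
    rewrite mnmDE v0 ?(disjointFl AH iH) // mnm1E.
    by case: eqVneq => // eji; move: iH; rewrite -eji (disjointFr GH jG).
  - rewrite memGH inE => mI; have := covGH k; rewrite orbA => /orP[//|kH].
    case/and3P: mI; split; apply/exists_inP.
    + by exists a; rewrite // !mnmDE v1.
    + by exists j; rewrite // !mnmDE !mnm1E !addn_gt0 eqxx ?orbT.
    + by exists k; rewrite // !mnmDE !mnm1E !addn_gt0 eqxx ?orbT.
have [disjC|meetC] := boolP [disjoint sd_vars (s:=D) i0 & C].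
  apply: leq_trans (bound C B C0 AC AB _ _ _ disjC) _.
  - by rewrite disjoint_sym.
  - by move=> i; rewrite [(_ \in C) || _]orbC.
  - by move=> m; rewrite memI; congr (_ && _); rewrite andbC.
  - by rewrite leq_add2l leq_maxr.
have disjB : [disjoint sd_vars (s:=D) i0 & B].
  apply/negPn/negP => /pred0Pn[j /andP[/= jZ jB]].
  move: meetC => /pred0Pn[k /andP[/= kZ kC]].
  have /negP := inner _ _ (in_space_mulX (in_space_mulX vi0 jZ) kZ); apply.
  rewrite memI; apply/and3P; split; apply/exists_inP.
  - by exists a; rewrite // !mnmDE v1.
  - by exists j; rewrite // !mnmDE !mnm1E !addn_gt0 eqxx ?orbT.
  - by exists k; rewrite // !mnmDE !mnm1E !addn_gt0 eqxx ?orbT.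
apply: leq_trans (bound B C B0 AB AC BC cov memI disjB) _.
by rewrite leq_add2l leq_maxl.
Qed.

Theorem corollary2p3 (K : fieldType) (n r e q : nat) :
  (0 < r)%N -> (r <= e)%N -> (e <= q)%N -> (r + e + q)%N = n ->
  let P1 : monomialIdeal K n :=
    var_ideal K [set i : 'I_n | (i < r)%N] in
  let P2 : monomialIdeal K n :=
    var_ideal K [set i : 'I_n | (r <= i < r + e)%N] in
  let P3 : monomialIdeal K n :=
    var_ideal K [set i : 'I_n | (r + e <= i < r + e + q)%N] in
  let I : monomialIdeal K n := ideal_cap (ideal_cap P1 P2) P3 in
  (sdepth (graded_quot I) <= e + uphalf q)%N.
Proof.
move=> r0 re eq nE; cbv zeta.
have card_range a b : (a + b <= n)%N ->
    #|[set i : 'I_n | (a <= i < a + b)%N]| = b.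
  (* b = \sum_(a <= i < a + b) 1, then widen the range to 0 <= i < n *)
  move=> abn; rewrite -sum1dep_card -[RHS](addKn a) -[RHS]muln1.
  rewrite -sum_nat_const_nat.
  rewrite (big_nat_widen _ _ n) // (big_nat_widenl _ 0%N) // big_mkord.
  by apply: eq_bigl => i; rewrite andbC.
have c1 : #|[set i : 'I_n | (i < r)%N]| = r by apply: (card_range 0 r); lia.
have c2 := card_range r e ltac:(lia).
have c3 := card_range (r + e)%N q ltac:(lia).
have le_bound : (r + maxn (uphalf e) (uphalf q) <= e + uphalf q)%N by lia.
have le_sdepth (I : monomialIdeal K n) := @sdepth_quot_transversal_le K n I
  [set i : 'I_n | (i < r)%N] [set i : 'I_n | (r <= i < r + e)%N]
  [set i : 'I_n | (r + e <= i < r + e + q)%N].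
rewrite c1 c2 c3 in le_sdepth.
apply: leq_trans le_bound; apply: le_sdepth; try lia.
- by apply/pred0P => i; rewrite !inE; apply/negbTE; lia.
- by apply/pred0P => i; rewrite !inE; apply/negbTE; lia.
- by apply/pred0P => i; rewrite !inE; apply/negbTE; lia.
- by move=> i; rewrite !inE; have := ltn_ord i; lia.
- by move=> m; rewrite -!(var_ideal_mpolyX K) andbA.
Qed.
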